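(* Let $\kappa$ be an infinite cardinal, let $\mathcal J\subseteq\mathcal J^\kappa_\omega$, let $\varkappa\le\kappa$ be a cardinal, and suppose that $\mathrm{unbounded}^+(\mathcal J,\varkappa)$ holds. Then (with $\theta\ge 2$ ranging over cardinals): (1) For every $\theta<\varkappa$, $\mathrm{unbounded}^+(\mathcal J,\theta)$ holds; (2) For every (infinite) regular $\theta<\varkappa$, $\mathrm{onto}^+(\mathcal J,\theta)$ holds; (3) For every $\theta\le\varkappa$ such that $2^\theta\le\kappa$, $\mathrm{onto}^+(\mathcal J,\theta)$ holds; (4) For every (infinite) regular $\theta<\varkappa$ such that $\mathrm{cf}([\kappa]^\theta,\subseteq)=\kappa$, $\mathrm{onto}^{++}(\mathcal J^\kappa_{\theta^{++}}\cap\mathcal J,\theta)$ holds.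
   Context: An ideal over $\kappa$ is a nonempty family $J$ of subsets of $\kappa$ closed under subsets and finite unions; it is $\nu$-complete if it is closed under unions of fewer than $\nu$ of its members; $J^+:=\mathcal P(\kappa)\setminus J$. $\mathcal J^\kappa_\nu$ is the collection of all $\nu$-complete ideals over $\kappa$ containing all bounded subsets of $\kappa$. $[\kappa]^2$ is identified with the set of pairs $(\alpha,\beta)$ with $\alpha<\beta<\kappa$. A colouring $c:[\kappa]^2\to\theta$ is upper-regressive if $c(\alpha,\beta)<\beta$ for all $\alpha<\beta<\kappa$. $[\kappa]^\theta$ is the collection of subsets of $\kappa$ of size $\theta$ (for $\theta$ infinite), and $\mathrm{cf}([\kappa]^\theta,\subseteq)$ is the least size of a cofinal subfamily. For a collection $\mathcal J$ of ideals over $\kappa$ and a cardinal $\theta$ with $2\le\theta\le\kappa$: - $\mathrm{onto}^{++}(\mathcal J,\theta)$: there is a colouring $c:[\kappa]^2\to\theta$ such that for every $J\in\mathcal J$ and every sequence $\langle B_\tau\mid\tau<\theta\rangle$ of elements of $J^+$ there is $\eta<\kappa$ such that $\{\beta\in B_\tau\setminus(\eta+1)\mid c(\eta,\beta)=\tau\}\in J^+$ for every $\tau<\theta$. - $\mathrm{onto}^+(\mathcal J,\theta)$: there is a colouring $c:[\kappa]^2\to\theta$ such that for every $J\in\mathcal J$ and every $B\in J^+$ there is $\eta<\kappa$ such that $\{\beta\in B\setminus(\eta+1)\mid c(\eta,\beta)=\tau\}\in J^+$ for every $\tau<\theta$. - $\mathrm{unbounded}^+(\mathcal J,\theta)$: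 there is an upper-regressive colouring $c:[\kappa]^2\to\theta$ such that for every $J\in\mathcal J$ and every $B\in J^+$ there is $\eta<\kappa$ such that $\mathrm{otp}(\{\tau<\theta\mid\{\beta\in B\setminus(\eta+1)\mid c(\eta,\beta)=\tau\}\in J^+\})=\theta$. *)

(* Defs.v *)
From HB Require Import structures.
From mathcomp Require Import all_boot all_order.
From mathcomp Require Import boolp classical_sets functions cardinality.

Set Implicit Arguments.
Unset Strict Implicit.
Unset Printing Implicit Defensive.

Local Open Scope order_scope.
Local Open Scope classical_set_scope.
Local Open Scope card_scope.

Definition card_lt (T U : Type) (A : set T) (B : set U) : Prop :=
  A #<= B /\ ~ (B #<= A).

(* The successor cardinal |A|^+, represented by a set of that cardinality.
   Since |A| < 2^|T| by Cantor, |A|^+ <= 2^|T|, so that a set of least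
   cardinality above |A| can be found among the subsets of [set T]; the two
   lemmas succ_card_gt and succ_card_least below confirm the choice. *)
Definition succ_card (T : Type) (A : set T) : set (set T) :=
  get [set B : set (set T) |
    card_lt A B /\ forall C : set (set T), card_lt A C -> B #<= C].

Section SuccCard.

(* Any nonempty family of cardinals has a least element. *)
Lemma card_least (I : Type) (i0 : I) (V : I -> Type)
    (C : forall i, set (V i)) :
  exists i, forall j, C i #<= C j.
Proof.
pose good (Y : set (forall i, V i)) :=
  (forall f, Y f -> forall i, C i (f i)) /\
  forall f g i, Y f -> Y g -> f i = g i -> f = g.
have [F Fgood Ftot|Y [[YC Yinj] Ymax]] := @Zorn_bigcup _ good.
  split=> [f [X FX Xf] i|f g i [X FX Xf] [X' FX' Xg] fg].
    by have [+ _] := Fgood _ FX; apply.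
  have [XX'|X'X] := Ftot _ _ FX FX'.
    by have [_ h] := Fgood _ FX'; apply: (h _ _ i) => //; exact: XX'.
  by have [_ h] := Fgood _ FX; apply: (h _ _ i) => //; exact: X'X.
have [i Yi] : exists i, forall x, C i x -> exists2 f, Y f & f i = x.
  apply: contrapT => noi.
  have new i : {x | C i x /\ forall f, Y f -> f i <> x}.
    apply: cid; apply: contrapT => nox; apply: noi; exists i => x Cx.
    apply: contrapT => nof; apply: nox; exists x; split => // f Yf fx.
    by apply: nof; exists f.
  pose g i := projT1 (new i).
  have gC i : C i (g i) by rewrite /g; case: (new i) => x [].
  have gnew i f : Y f -> f i <> g i.
    by rewrite /g; case: (new i) => x [_ nx] Yf /=; exact: nx.
  apply: (Ymax (Y `|` [set g])).
    split; first by move=> f; left.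
    by move=> /(_ g (or_intror erefl)) Yg; exact: (gnew i0 g Yg).
  split=> [f [Yf|->] i|f h i [Yf|->] [Yh|->] //]; [exact: YC|exact: gC|..].
  - by apply: Yinj.
  - by move=> /gnew; case.
  - by move=> /esym /gnew; case.
exists i => j.
have [Ci0|/set0P[x0 Cx0]] := eqVneq (C i) set0.
  by rewrite Ci0; exact: card_ge0.
have [f0 Yf0 _] := Yi _ Cx0.
have lift x : {f | C i x -> Y f /\ f i = x}.
  apply: cid; have [/Yi[f Yf fx]|nx] := pselect (C i x); first by exists f.
  by exists f0.
pose h x := projT1 (lift x) j.
have hC : set_fun (C i) (C j) h.
  by move=> x Cx; rewrite /h; case: (lift x) => f /= /(_ Cx)[Yf _]; exact: YC.
have hinj : {in C i &, injective h}.
  move=> x y /set_mem Cx /set_mem Cy; rewrite /h.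
  case: (lift x) (lift y) => f /= /(_ Cx)[Yf <-] [g /= /(_ Cy)[Yg <-]].
  by move=> /(Yinj _ _ _ Yf Yg) ->.
rewrite -(card_le_eql (inj_card_eq hinj)).
by apply: subset_card_le => _ [x /hC + <-].
Qed.

Lemma card_lt_powerset (T : Type) (A : set T) : card_lt A [set: set T].
Proof.
split.
  apply/pcard_injP; exists (fun x => [set x]) => x y _ _ xy.
  by have : [set y] x by rewrite -xy.
move=> /card_le_trans /(_ (card_leT A)) /card_leP[g].
pose f (X : set T) : T := val (g (SigSub (mem_set (I : [set: set T] X)))).
have finj : injective f.
  by move=> X Y /val_inj /(inj (mem_set I) (mem_set I)) [].
pose D := [set f X | X in [set X | ~ X (f X)]].
have nD : ~ D (f D) by move=> DD; have [X nX /finj XD] := DD; apply: nX; rewrite XD.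
by apply: (nD); exists D.
Qed.

Lemma succ_cardP (T : Type) (A : set T) :
  card_lt A (succ_card A) /\
  forall C : set (set T), card_lt A C -> succ_card A #<= C.
Proof.
rewrite /succ_card; set P := (X in get X).
suff : P (get P) by [].
apply: getPex.
have [[B AB] Bmin] := @card_least {B : set (set T) | card_lt A B}
  (exist _ _ (card_lt_powerset A)) (fun=> set T) (fun i => proj1_sig i).
by exists B; split=> // C ltC; exact: (Bmin (exist _ C ltC)).
Qed.

Lemma succ_card_gt (T : Type) (A : set T) : card_lt A (succ_card A).
Proof. by case: (succ_cardP A). Qed.

Lemma succ_card_least (T V : Type) (A : set T) (C : set V) :
  card_lt A C -> succ_card A #<= C.
Proof.
move=> [leAC leCA]; have [_ Smin] := succ_cardP A.
have [[] Cmin] := @card_least bool true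
  (fun b => if b then V else set T)
  (fun b => if b return set (if b then V else set T) then C else succ_card A).
  have /pcard_leP[f] := Cmin false.
  have fC : f @` C #= C by apply: inj_card_eq; exact: inj.
  rewrite -(card_le_eqr fC); apply: Smin.
  by split; rewrite ?(card_le_eqr fC) ?(card_le_eql fC).
exact: Cmin true.
Qed.

End SuccCard.

(* Throughout, kappa is a type K whose order is a well-order of an infinite
   initial ordinal.  As with von Neumann ordinals, the ordinals at most kappa
   are the initial segments of K, an element of K being identified with the
   segment below it.  So [theta `<=` mu] and [theta `<` mu] are the usual order
   on ordinals, and a colouring [kappa]^2 -> theta is a function K -> K -> K
   with values in theta on pairs a < b (its other values are irrelevant). *)
Section Colourings.
Context {d : Order.disp_t} {K : orderType d}.
Implicit Types (A B theta : set K) (J : set (set K)) (Js : set (set (set K))).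
Implicit Type c : K -> K -> K.

Definition below (a : K) : set K := [set x | x < a].

Definition is_ordinal A : Prop := forall x y, x <= y -> A y -> A x.

Definition is_cardinal A : Prop :=
  is_ordinal A /\ forall x, A x -> card_lt (below x) A.

Definition is_infinite_regular A : Prop :=
  [/\ is_cardinal A, infinite_set A &
    forall X, X `<=` A -> (forall a, A a -> exists2 x, X x & a <= x) ->
      X #= A].

(* For X `<=` A with A an ordinal: the order type of X is A. *)
Definition otp_eq (X A : set K) : Prop :=
  exists f : K -> K, set_bij X A f /\
    forall x y, X x -> X y -> x < y -> f x < f y.

Definition is_ideal J : Prop :=
  [/\ J !=set0,
      forall A B, A `<=` B -> J B -> J A &
      forall A B, J A -> J B -> J (A `|` B)].

(* The cardinal nu is given by any set N of cardinality nu. *)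
Definition is_complete (V : Type) (N : set V) J : Prop :=
  forall F : set (set K), F `<=` J -> card_lt F N -> J (\bigcup_(X in F) X).

(* The collection of nu-complete ideals containing the bounded sets. *)
Definition ideals (V : Type) (N : set V) : set (set (set K)) :=
  [set J | [/\ is_ideal J, is_complete N J & forall A, has_ubound A -> J A]].

Definition is_colouring theta c : Prop := forall a b, a < b -> theta (c a b).

Definition upper_regressive c : Prop := forall a b, a < b -> c a b < b.

Definition fibre c B (eta tau : K) : set K :=
  [set b | [/\ B b, eta < b & c eta b = tau]].

Definition onto_pp Js theta : Prop :=
  exists c, is_colouring theta c /\
    forall J, Js J -> forall B : K -> set K,
      (forall tau, theta tau -> ~ J (B tau)) ->
      exists eta, forall tau, theta tau -> ~ J (fibre c (B tau) eta tau).

Definition onto_p Js theta : Prop :=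
  exists c, is_colouring theta c /\
    forall J, Js J -> forall B, ~ J B ->
      exists eta, forall tau, theta tau -> ~ J (fibre c B eta tau).

Definition unbounded_p Js theta : Prop :=
  exists c, [/\ is_colouring theta c, upper_regressive c &
    forall J, Js J -> forall B, ~ J B ->
      exists eta,
        otp_eq [set tau | theta tau /\ ~ J (fibre c B eta tau)] theta].

(* [kappa]^theta, for theta infinite. *)
Definition subsets_of_size theta : set (set K) := [set X | X #= theta].

Definition cofinal_family (P D : set (set K)) : Prop :=
  D `<=` P /\ forall X, P X -> exists2 Y, D Y & X `<=` Y.

(* cf(P, `<=`) is the cardinality of N. *)
Definition cf_eq (P : set (set K)) (V : Type) (N : set V) : Prop :=
  (exists D, cofinal_family P D /\ D #= N) /\
  forall D, cofinal_family P D -> N #<= D.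

End Colourings.

(* Main.v *)
(* Write theta^+ for the successor of a regular theta < mu. All four parts
   compose the given colouring c with maps f_i (i < kappa), the index i being
   coded together with eta. So one needs few maps f_i such that every T of
   type mu is mapped onto a large set (or onto theta) by one of them.

   Onto theta: fix injections e_b : b -> theta for b < theta^+ and a
   partition of the points of cofinality theta into stationary sets S_g
   (g < theta), with s(x) = g for x in S_g. For indices xi, al put
   F(b) = s(min {x >= al | x < b, e_b(x) <= e_b(xi)}). Let T_g (g < theta) be
   unbounded in theta^+ and, for x in S_g, let b = b(g, x) > x be in T_g. On a
   stationary set e_b(x) = nu_g is constant. As e_b is injective, all but
   theta many xi allow e_b(xi) to be a constant mu_g >= nu_g on a stationary
   set; fix xi good for all g. Then {y < x | e_b(y) <= mu_g} has size < theta,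
   so it is bounded below x, by a bound which does not depend on x when x ranges
   over some unbounded set. For al above all these bounds the minimum
   defining F(b) is x itself, so F(b) = g. The point is that the threshold
   e_b(xi) is read off b, hence may depend on g although (xi, al) does not.

   For part (4) the T_g come from phi(b) = sup {c(y, b) | y in Y}, where Y is a
   member of the cofinal family containing all the eta needed. *)
Require Import Defs.
From mathcomp Require Import all_boot all_order.
From mathcomp Require Import boolp classical_sets functions cardinality.

Set Implicit Arguments.
Unset Strict Implicit.
Unset Printing Implicit Defensive.

Import Order.TTheory.

Local Open Scope order_scope.
Local Open Scope classical_set_scope.
Local Open Scope card_scope.

(** * Cardinal arithmetic on well-ordered sets *)

Section Cardinality.
Context {T U : Type}.
Implicit Types (A : set T) (B : set U).

Lemma inj_card A B (f : T -> U) : (forall x, A x -> B (f x)) ->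
  (forall x y, A x -> A y -> f x = f y -> x = y) -> A #<= B.
Proof.
move=> fAB finj; have : A #= f @` A.
  apply: card_esym; apply: inj_card_eq => x y /set_mem Ax /set_mem Ay.
  exact: finj.
move=> /card_le_eql ->.
by apply: subset_card_le => _ [x Ax <-]; exact: fAB.
Qed.

Lemma card_inj A B (u0 : U) : A #<= B -> exists f : T -> U,
  (forall x, A x -> B (f x)) /\
  (forall x y, A x -> A y -> f x = f y -> x = y).
Proof.
move=> /card_leP[g].
pose f x := if pselect (A x) is left Ax
  then val (g (SigSub (mem_set Ax))) else u0.
have fE x (Ax : A x) : f x = val (g (SigSub (mem_set Ax))).
  rewrite /f; case: pselect => // Ax'.
  by rewrite (Prop_irrelevance Ax Ax').
exists f; split=> [x Ax|x y Ax Ay].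
  by rewrite (fE _ Ax); apply: set_mem; exact: valP.
rewrite (fE _ Ax) (fE _ Ay) => /val_inj.
by move=> /(inj (mem_set I) (mem_set I)) [].
Qed.

Lemma card_surj A B (t0 : T) : A #<= B ->
  exists g : U -> T, forall x, A x -> exists2 u, B u & g u = x.
Proof.
move=> AB.
have [[u0 _]|B0] := pselect (B !=set0); last first.
  exists (fun=> t0) => x Ax.
  suff : A #<= @set0 U by move=> /card_le0P A0; rewrite A0 in Ax.
  by have <- : B = set0 by apply: contrapT => /eqP /set0P.
have [f [fB finj]] := card_inj u0 AB.
have lift u : exists x, (exists2 y, A y & f y = u) -> A x /\ f x = u.
  have [[y Ay fy]|nx] := pselect (exists2 y, A y & f y = u).
    by exists y.
  by exists t0.
have [g gP] := choice lift.
exists g => x Ax; exists (f x); first exact: fB.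
have [|Ag fg] := gP (f x); first by exists x.
exact: finj.
Qed.

Lemma surj_card A B (g : U -> T) :
  (forall x, A x -> exists2 u, B u & g u = x) -> A #<= B.
Proof.
move=> gP; have -> : A = g @` (B `&` g @^-1` A).
  apply/seteqP; split=> [x Ax|_ [u [_ +] <-] //].
  by have [u Bu gu] := gP x Ax; exists u => //; split; rewrite /preimage/= ?gu.
apply: card_le_trans (card_image_le _ _) _.
by apply: subset_card_le => u [].
Qed.

Lemma card_le_total A B : A #<= B \/ B #<= A.
Proof.
have [b bP] := @card_least bool true (fun b => if b then T else U)
  (fun b => if b return set (if b then T else U) then A else B).
by case: b bP => bP; [left; exact: (bP false)|right; exact: (bP true)].
Qed.

Lemma card_ltNge A B : ~ (B #<= A) -> A #<= B.
Proof. by move=> nBA; have [] := card_le_total A B. Qed.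

End Cardinality.

Lemma card_le_setX (T1 T2 U1 U2 : Type) (A1 : set T1) (A2 : set T2)
    (B1 : set U1) (B2 : set U2) :
  A1 #<= B1 -> A2 #<= B2 -> A1 `*` A2 #<= B1 `*` B2.
Proof.
move=> AB1 AB2.
have [/= A0|/set0P[[a1 a2] [/= Aa1 Aa2]]] := eqVneq (A1 `*` A2) set0.
  by rewrite A0; exact: card_ge0.
have [g1 g1P] := card_surj a1 AB1.
have [g2 g2P] := card_surj a2 AB2.
apply: (@surj_card _ _ _ _ (fun u => (g1 u.1, g2 u.2))) => -[x1 x2] [/= Ax1 Ax2].
have [u1 Bu1 <-] := g1P _ Ax1; have [u2 Bu2 <-] := g2P _ Ax2.
by exists (u1, u2).
Qed.

Lemma card_bigcup_le (T I V W : Type) (A : set I) (F : I -> set T)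
    (B : set V) (C : set W) :
  A #<= B -> (forall i, A i -> F i #<= C) ->
  \bigcup_(i in A) F i #<= B `*` C.
Proof.
move=> AB FC.
have [->|/set0P[t0 [i0 Ai0 Ft0]]] := eqVneq (\bigcup_(i in A) F i) set0.
  exact: card_ge0.
have [a aP] := card_surj i0 AB.
have /choice[g gP] : forall i, exists g : W -> T,
    A i -> forall x, F i x -> exists2 w, C w & g w = x.
  move=> i; have [Ai|nAi] := pselect (A i); last by exists (fun=> t0).
  by have [g gP] := card_surj t0 (FC i Ai); exists g.
apply: (@surj_card _ _ _ _ (fun p => g (a p.1) p.2)) => x [i Ai Fx].
have [v Bv av] := aP _ Ai; have [w Cw gw] := gP _ Ai _ Fx.
by exists (v, w) => //=; rewrite av.
Qed.

(** Every recursion below needs only the set of earlier values, so [F] takes that set and the proofs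
    of [R q p] disappear from the fixed point equation. *)
Lemma wf_rec (T U : Type) (R : T -> T -> Prop) (F : T -> set U -> U) :
  well_founded R ->
  exists f : T -> U, forall p, f p = F p (f @` [set q | R q p]).
Proof.
move=> wfR.
pose G p (h : forall q, R q p -> U) :=
  F p [set u | exists q (Rqp : R q p), h q Rqp = u].
exists (Fix wfR (fun=> U) G) => p.
rewrite Fix_eq.
  rewrite /G; congr F; apply/seteqP; split=> u.
    by move=> [q [Rqp <-]]; exists q.
  by move=> [q Rqp <-]; exists q, Rqp.
move=> x f g fg; rewrite /G; congr F; apply/funext => u.
by apply/propext; split=> -[q [Rqx <-]]; exists q, Rqx; rewrite fg.
Qed.

(** Hilbert's hotel: along an injective sequence [g] in [C], the map [s] sends [g 0] to [x] and
    [g (n+1)] to [g n], and fixes all other points. *)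
Lemma card_setU1 (T : Type) (C : set T) (x : T) :
  infinite_set C -> C `|` [set x] #<= C.
Proof.
move=> /infiniteP /(card_inj x)[g [gC ginj]].
have /choice[s sP] : forall y, exists z, [/\ y = g 0%N -> z = x,
    forall n, y = g n.+1 -> z = g n & (forall n, y <> g n) -> z = y].
  move=> y; have [[[|n] ->]|no] := pselect (exists n, y = g n).
  - by exists x; split=> // [n /ginj //|/(_ 0%N)//]; move/(_ I I).
  - by exists (g n); split=> [/ginj|m /ginj|/(_ n.+1)//]; move/(_ I I) => // -[->].
  - exists y; split=> // [y0|n yn]; exfalso; apply: no; by [exists 0%N|exists n.+1].
apply: (@surj_card _ _ _ _ s) => y [Cy|->].
  have [[n yn]|no] := pselect (exists n, y = g n).
    exists (g n.+1); first exact: gC.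
    by rewrite yn; have [_ /(_ n erefl)] := sP (g n.+1).
  exists y => //; have [_ _] := sP y; apply.
  by move=> n yn; apply: no; exists n.
exists (g 0%N); first exact: gC.
by have [->] := sP (g 0%N).
Qed.

(** * Least elements, order types and squares of infinite cardinals *)

Section WellOrder.
Context {d : Order.disp_t} {K : orderType d}.
Context (wfK : well_founded (fun x y : K => x < y)).
Implicit Types (A X : set K) (x y : K).

Definition is_least (P : set K) x := P x /\ forall y, P y -> x <= y.

Definition least (k0 : K) (P : set K) : K := xget k0 (is_least P).

Lemma leastP (k0 : K) (P : set K) x : P x -> is_least P (least k0 P).
Proof.
move=> Px; apply: xgetPex; elim/(well_founded_ind wfK): x Px => x IH Px.
have [[y [Py yx]]|no] := pselect (exists y, P y /\ y < x); first exact: IH Py.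
exists x; split=> // y Py; rewrite leNgt; apply/negP => yx.
by apply: no; exists y.
Qed.

Lemma ordinal_sub A B : is_ordinal A -> is_ordinal B -> ~ A `<=` B ->
  exists2 x, A x & B `<=` below x.
Proof.
move=> oA oB AB; have [x [Ax nBx]] : exists x, A x /\ ~ B x.
  apply: contrapT => no; apply: AB => x Ax; apply: contrapT => nBx.
  by apply: no; exists x.
exists x => // y By; rewrite /below /= ltNge; apply/negP => xy.
by apply: nBx; exact: oB xy By.
Qed.

Lemma below_ordinal x : is_ordinal (below x).
Proof. by move=> y z yz zx; exact: le_lt_trans yz zx. Qed.

Lemma le_below x : [set y | y <= x] = below x `|` [set x].
Proof.
apply/seteqP; split=> y /=; rewrite le_eqVlt.
  by move=> /orP[/eqP->|]; [right|left].
by move=> [-> | ->]; rewrite ?eqxx ?orbT.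
Qed.

(** The Mostowski collapse of [X]: [f x] is the least value not taken before [x]. If some [a] in [A]
    were missed, all values would lie below [a], and [f] would inject [X] into [below a]. *)
Lemma collapse_otp A X : is_ordinal A -> X `<=` A ->
  (forall a, A a -> ~ (X #<= below a)) -> otp_eq X A.
Proof.
move=> oA XA Xbig.
have [A0|/set0P[k0 Ak0]] := eqVneq A set0.
  have X0 : X = set0 by apply/seteqP; split=> // x /XA; rewrite A0.
  by exists id; split=> //; rewrite A0 X0; split=> // x [].
have wfX : well_founded (fun y x => X y /\ y < x).
  by move=> x; elim/(well_founded_ind wfK): x => x IH; constructor=> y [_ /IH].
have [f fE] := wf_rec (fun _ (V : set K) => least k0 (~` V)) wfX.
(* By induction all earlier values are below [x], so [x] itself is still free and [least] never
   falls back on [k0]. *)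
have fle x : f x <= x.
  elim/(well_founded_ind wfK): x => x IH.
  rewrite fE; apply: (@leastP k0 _ x _).2; move=> -[z [_ zx] fz];
    by have := IH _ zx; rewrite fz leNgt zx.
have fnew x : is_least (~` (f @` [set y | X y /\ y < x])) (f x).
  rewrite fE; apply: (@leastP _ _ x) => -[z [_ zx] fz].
  by have := fle z; rewrite fz leNgt zx.
have flt x y : X x -> x < y -> f x < f y.
  move=> Xx xy; rewrite lt_neqAle; apply/andP; split.
    by apply/eqP => fxy; apply: (fnew y).1; exists x.
  apply: (fnew x).2 => -[z [Xz zx] fz]; apply: (fnew y).1; exists z => //.
  by split=> //; exact: lt_trans zx xy.
have finj x y : X x -> X y -> f x = f y -> x = y.
  move=> Xx Xy fxy; case: (ltgtP x y) => // [/(flt _ _ Xx)|/(flt _ _ Xy)];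
    by rewrite fxy ltxx.
exists f; split=> [|x y Xx _]; last exact: flt.
split=> [x Xx|x y /set_mem Xx /set_mem Xy|]; [|exact: finj|].
  exact: oA (fle x) (XA _ Xx).
move=> a Aa; apply: contrapT => na.
apply: (Xbig a Aa); apply: (@inj_card _ _ _ _ f) => // x Xx.
rewrite /below/= ltNge; apply/negP => le_a; apply: na.
have [<-|ax] := eqVneq (f x) a; first by exists x.
have {}le_a : a < f x by rewrite lt_neqAle eq_sym ax.
apply: contrapT => na.
have : f x <= a; last by rewrite leNgt le_a.
apply: (fnew x).2 => -[z [Xz zx] fz]; apply: na; by exists z.
Qed.

Lemma cardinal_otp A X : is_cardinal A -> X `<=` A -> A #<= X -> otp_eq X A.
Proof.
move=> [oA cA] XA AX; apply: collapse_otp => // a /cA[_ nA] Xa.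
by apply: nA; exact: card_le_trans AX Xa.
Qed.

Lemma otp_card X A : otp_eq X A -> X #= A.
Proof.
move=> [f [fb _]]; have [f' _] := Pbij fb; exact: pcard_eq f'.
Qed.

Lemma cardinal_no_max A x : is_cardinal A -> infinite_set A -> A x ->
  exists2 y, A y & x < y.
Proof.
move=> [oA cA] iA Ax; apply: contrapT => no.
have Ale : A `<=` [set y | y <= x].
  by move=> y Ay; rewrite /= leNgt; apply/negP => xy; apply: no; exists y.
have nfin : infinite_set (below x).
  move=> fin; apply: iA; apply: sub_finite_set Ale _.
  by rewrite le_below finite_setU; split.
have [_] := cA _ Ax; apply.
apply: card_le_trans (subset_card_le Ale) _.
by rewrite le_below; exact: card_setU1.
Qed.

Lemma card_le_below_U1 A a : is_cardinal A -> infinite_set A -> A a ->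
  card_lt [set y | y <= a] A.
Proof.
move=> cA iA Aa; have [b Ab ab] := cardinal_no_max cA iA Aa.
have sub : [set y | y <= a] `<=` below b by move=> y /= ya; exact: le_lt_trans ya ab.
have [bA nAb] := cA.2 _ Ab; split; first exact: card_le_trans (subset_card_le sub) bA.
by move=> Aa'; apply: nAb; exact: card_le_trans Aa' (subset_card_le sub).
Qed.

(* Goedel's well-order of pairs. *)
Definition pair_lt (p q : K * K) : Prop :=
  let m (p : K * K) := Order.max p.1 p.2 in
  m p < m q \/ m p = m q /\ (p.1 < q.1 \/ p.1 = q.1 /\ p.2 < q.2).

Lemma pair_lt_wf : well_founded pair_lt.
Proof.
suff acc m a b : Order.max a b = m -> Acc pair_lt (a, b).
  by move=> [a b]; exact: acc erefl.
elim/(well_founded_ind wfK): m a b => m IHm a.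
elim/(well_founded_ind wfK): a => a IHa b.
elim/(well_founded_ind wfK): b => b IHb abm.
constructor=> -[a' b'] [|[]] /=; rewrite abm.
  by move=> lt_m; exact: IHm lt_m _ _ erefl.
move=> eq_m [lt_a|[eq_a lt_b]]; first exact: IHa.
by subst a'; exact: IHb.
Qed.

Lemma pair_lt_total p q : p = q \/ pair_lt p q \/ pair_lt q p.
Proof.
have tri (x y : K) : [\/ x = y, x < y | y < x].
  by case: (ltgtP x y) => ?; [apply: Or32|apply: Or33|apply: Or31].
case: p q => [a b] [a' b']; rewrite /pair_lt /=.
case: (tri (Order.max a b) (Order.max a' b')) => [->|lt|lt];
  [|by right; left; left|by right; right; left].
case: (tri a a') => [->|lt|lt];
  [|by right; left; right; split=> //; left|
    by right; right; right; split=> //; left].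
case: (tri b b') => [->|lt|lt]; [by left|
  by right; left; right; split=> //; right|
  by right; right; right; split=> //; right].
Qed.

(** Values in [A] are assigned along Goedel's order, each time a fresh one. They never run out: the
    predecessors of [p] lie in the square of some [below m'] with [m'] in [A], which is finite or,
    by hypothesis, no larger than [below m']. *)
Lemma cardinal_square_step A : is_cardinal A -> infinite_set A ->
  (forall x, A x -> infinite_set (below x) ->
    below x `*` below x #<= below x) ->
  A `*` A #<= A.
Proof.
move=> cA iA IH; have [k0 _] := infinite_setN0 iA.
have wfR : well_founded (fun q p => (A `*` A) q /\ pair_lt q p).
  by move=> p; elim/(well_founded_ind pair_lt_wf): p => p IHp;
    constructor=> q [_ /IHp].
have [f fE] := wf_rec (fun _ V => xget k0 (A `\` V)) wfR.
have fA p : (A `*` A) p ->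
    (A `\` f @` [set q | (A `*` A) q /\ pair_lt q p]) (f p).
  move=> Ap; rewrite fE; apply: xgetPex; apply: contrapT => no.
  have Am : A (Order.max p.1 p.2).
    by rewrite /Order.max; case: ifP; case: Ap.
  have [m' Am' mm'] := cardinal_no_max cA iA Am.
  have [m'A nAm'] := cA.2 _ Am'.
  have Ale : A #<= below m' `*` below m'.
    apply: (@surj_card _ _ _ _ f) => a Aa.
    have : (f @` [set q | (A `*` A) q /\ pair_lt q p]) a.
      by apply: contrapT => na; apply: no; exists a.
    move=> [q [_ qp] <-]; exists q => //.
    have : Order.max q.1 q.2 < m'.
      by case: qp => [|[-> _]] //; move=> /lt_trans; apply.
    by rewrite gt_max => /andP[].
  have [fin|inf] := pselect (finite_set (below m')).
    by apply: iA; apply: card_le_finite Ale _; exact: finite_setX.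
  by apply: nAm'; exact: card_le_trans Ale (IH _ Am' inf).
apply: (@inj_card _ _ _ _ f) => [p /fA[]//|p q Ap Aq fpq].
have [//|[pq|qp]] := pair_lt_total p q.
- by have [_ []] := fA _ Aq; exists p.
- by have [_ []] := fA _ Ap; exists q.
Qed.

(** If [below x] is not a cardinal, it injects into some [below y] with [y < x], where the induction
    hypothesis applies. *)
Lemma below_square x : infinite_set (below x) -> below x `*` below x #<= below x.
Proof.
elim/(well_founded_ind wfK): x => x IH ix.
have [cx|ncx] := pselect (is_cardinal (below x)).
  by apply: cardinal_square_step => // y yx; exact: IH.
have [y [yx xy]] : exists y, y < x /\ below x #<= below y.
  apply: contrapT => no; apply: ncx; split; first exact: below_ordinal.
  move=> y yx; split.
    by apply: subset_card_le => z zy; exact: lt_trans zy yx.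
  by move=> xy; apply: no; exists y.
have iy : infinite_set (below y) by move=> fin; apply: ix; exact: card_le_finite xy fin.
apply: card_le_trans (card_le_setX xy xy) _.
apply: card_le_trans (IH _ yx iy) _.
by apply: subset_card_le => z zy; exact: lt_trans zy yx.
Qed.

Lemma cardinal_square A : is_cardinal A -> infinite_set A -> A `*` A #<= A.
Proof.
by move=> cA iA; apply: cardinal_square_step => // x _; exact: below_square.
Qed.

Lemma cardinal_bigcup A (I T : Type) (D : set I) (F : I -> set T) :
  is_cardinal A -> infinite_set A ->
  D #<= A -> (forall i, D i -> F i #<= A) -> \bigcup_(i in D) F i #<= A.
Proof.
move=> cA iA DA FA.
exact: card_le_trans (card_bigcup_le DA FA) (cardinal_square cA iA).
Qed.

Lemma cardinal_setU A (T : Type) (X Y : set T) :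
  is_cardinal A -> infinite_set A -> X #<= A -> Y #<= A -> X `|` Y #<= A.
Proof.
move=> cA iA XA YA.
have -> : X `|` Y = \bigcup_(b in [set: bool]) (if b then X else Y).
  apply/seteqP; split=> [t [Xt|Yt]|t [[] _]]; [by exists true|by exists false|
    by left|by right].
apply: cardinal_bigcup => // [|[]//].
apply: card_le_trans (proj1 (infiniteP A) iA).
exact: countableP.
Qed.

(** * The successor cardinal as an initial segment of [K] *)

Section Successor.
Context (theta : set K) (cth : is_cardinal theta) (ith : infinite_set theta).
Context (thK : ~ ([set: K] #<= theta)).

(** For an infinite cardinal [theta] smaller than [K] this is the successor cardinal, realised
    inside [K] so that its elements can serve as colours. *)
Definition next_card : set K := [set x | below x #<= theta].
Local Notation L := next_card.

Lemma next_ordinal : is_ordinal L.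
Proof.
move=> x y xy; apply: card_le_trans; apply: subset_card_le => z zx.
exact: lt_le_trans zx xy.
Qed.

Lemma next_gt : ~ (L #<= theta).
Proof.
move=> Lth; have [LT|] := pselect (forall x, L x).
  by apply: thK; rewrite -(_ : L = [set: K]) //; apply/seteqP; split.
move=> /existsNP[x0 nLx0]; have [nL xL] := leastP (P := ~` L) x0 nLx0.
apply: nL; apply: card_le_trans Lth; apply: subset_card_le => y yx.
apply: contrapT => /xL; rewrite leNgt; apply/negP/negPn; exact: yx.
Qed.

Lemma sub_next : theta `<=` L.
Proof. by move=> x /cth.2[]. Qed.

(** Regularity of the successor: the downward closure of [X] is a union of at most [theta] sets of
    size at most [theta], so it does not cover [L]. *)
Lemma next_sup X : X `<=` L -> X #<= theta -> exists2 b, L b & X `<=` below b.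
Proof.
move=> XL Xth; pose U := \bigcup_(x in X) [set y | y <= x].
have Uth : U #<= theta.
  apply: cardinal_bigcup => // x Xx; rewrite le_below.
  apply: cardinal_setU => //; first exact: XL.
  have [t0 th0] := infinite_setN0 ith.
  by apply: (@inj_card _ _ _ _ (fun=> t0)) => // y z -> ->.
have [|||b Lb Ub] := @ordinal_sub L U; first exact: next_ordinal.
- by move=> y z yz [x Xx zx]; exists x => //; exact: le_trans yz zx.
- by move=> /subset_card_le LU; apply: next_gt; exact: card_le_trans LU Uth.
by exists b => // x Xx; apply: Ub; exists x => //=.
Qed.

Lemma next_unbounded X : X `<=` L -> ~ (X #<= theta) ->
  forall b, L b -> exists2 x, X x & b <= x.
Proof.
move=> XL Xth b Lb; apply: contrapT => no; apply: Xth.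
apply: card_le_trans Lb; apply: subset_card_le => x Xx.
by rewrite /below/= ltNge; apply/negP => bx; apply: no; exists x.
Qed.

Lemma next_otp X : X `<=` L -> ~ (X #<= theta) -> otp_eq X L.
Proof.
move=> XL Xth; apply: collapse_otp => // [|a La Xa]; first exact: next_ordinal.
by apply: Xth; exact: card_le_trans Xa La.
Qed.

Lemma next_cardinal : is_cardinal L.
Proof.
split=> [|x Lx]; first exact: next_ordinal.
split; last by move=> Lbx; apply: next_gt; exact: card_le_trans Lbx Lx.
by apply: subset_card_le => y yx; exact: next_ordinal (ltW yx) Lx.
Qed.

Lemma next_infinite : infinite_set L.
Proof. by move=> fin; apply: ith; exact: sub_finite_set sub_next fin. Qed.

Lemma next_regular : is_infinite_regular L.
Proof.
split; [exact: next_cardinal|exact: next_infinite|move=> X XL Xcof].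
apply: otp_card; apply: next_otp => // /(next_sup XL)[b /Xcof[x Xx bx]].
by move=> /(_ _ Xx); rewrite /below/= ltNge bx.
Qed.

(** This compares [L] with [succ_card], which lives in another type. A set above [theta] that embeds
    into [L] has an image of full order type there. *)
Lemma next_least (V : Type) (C : set V) : card_lt theta C -> L #<= C.
Proof.
move=> [_ nC]; have [//|CL] := card_le_total L C.
have [l0 _] := infinite_setN0 next_infinite.
have [f [fL finj]] := card_inj l0 CL.
have Cf : C #= f @` C.
  apply: card_esym; apply: inj_card_eq => x y /set_mem Cx /set_mem Cy.
  exact: finj.
have fCL : f @` C `<=` L by move=> _ [x Cx <-]; exact: fL.
have /(next_otp fCL)/otp_card/card_esym : ~ (f @` C #<= theta).
  by rewrite -(card_le_eql Cf).
by rewrite card_eq_le (card_le_eqr Cf) => /andP[].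
Qed.

End Successor.
End WellOrder.

(** * Stationary sets and maps onto a regular cardinal *)

Section Stationary.
Context {d : Order.disp_t} {K : orderType d}.
Context (wfK : well_founded (fun x y : K => x < y)).
Context (theta : set K) (rth : is_infinite_regular theta).
Context (thK : ~ ([set: K] #<= theta)).
Implicit Types (X : set K) (x y a b : K).
Local Notation L := (next_card theta).

Let cth : is_cardinal theta. Proof. by case: rth. Qed.
Let ith : infinite_set theta. Proof. by case: rth. Qed.
Let cL : is_cardinal L. Proof. exact: next_cardinal. Qed.
Let iL : infinite_set L. Proof. exact: next_infinite. Qed.
Let oL : is_ordinal L. Proof. exact: next_ordinal. Qed.
Let supL X : X `<=` L -> X #<= theta -> exists2 b, L b & X `<=` below b.
Proof. exact: next_sup. Qed.

Lemma regular_sup X : X `<=` theta -> card_lt X theta ->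
  exists2 i, theta i & X `<=` below i.
Proof.
move=> Xth [_ nX]; apply: contrapT => no; apply: nX.
case: rth => _ _ /(_ X Xth) reg.
suff /reg : forall a, theta a -> exists2 x, X x & a <= x.
  by rewrite card_eq_le => /andP[].
move=> a tha; apply: contrapT => nx; apply: no; exists a => // x Xx.
by rewrite /below/= ltNge; apply/negP => ax; apply: nx; exists x.
Qed.

Lemma next_le_below a : L a -> [set y | y <= a] #<= theta.
Proof.
move=> La; have [b Lb ab] := cardinal_no_max cL iL La.
apply: card_le_trans Lb; apply: subset_card_le => y /= ya.
exact: le_lt_trans ya ab.
Qed.

(* By Fodor's lemma these are, among the subsets of theta^+, the nonstationary
   ones; the ideal properties needed below are immediate from this form. *)
Definition nonstationary X : Prop :=
  exists f : K -> K, (forall x, X x -> f x < x) /\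
    forall l, exists2 b, L b & forall x, X x -> f x = l -> x < b.

Lemma nonstationary_sub X Y : X `<=` Y -> nonstationary Y -> nonstationary X.
Proof.
move=> XY [f [freg fb]]; exists f; split=> [x /XY /freg//|l].
by have [b Lb bP] := fb l; exists b => // x /XY; exact: bP.
Qed.

(** The regressive maps are glued along a choice of an index [c x] with [x] in [X (c x)]. A fibre of
    the glued map is bounded by the supremum of at most [theta] bounds. *)
Lemma nonstationary_bigcup (I : Type) (D : set I) (X : I -> set K) :
  D #<= theta -> (forall i, D i -> nonstationary (X i)) ->
  nonstationary (\bigcup_(i in D) X i).
Proof.
move=> Dth NX.
have [[x0 [i0 Di0 Xx0]]|no] := pselect (\bigcup_(i in D) X i !=set0); last first.
  have [l0 Ll0] := infinite_setN0 iL.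
  exists id; split=> [x Xx|l]; first by exfalso; apply: no; exists x.
  by exists l0 => // x Xx; exfalso; apply: no; exists x.
have /choice[f fP] : forall i, exists f : K -> K, D i ->
    (forall x, X i x -> f x < x) /\
    forall l, exists2 b, L b & forall x, X i x -> f x = l -> x < b.
  move=> i; have [Di|nDi] := pselect (D i); last by exists id.
  by have [f fP] := NX i Di; exists f.
have /choice[c cP] : forall x, exists i,
    (\bigcup_(i in D) X i) x -> D i /\ X i x.
  move=> x; have [[i Di Xx]|nx] := pselect ((\bigcup_(i in D) X i) x).
    by exists i.
  by exists i0.
exists (fun x => f (c x) x); split=> [x /cP[Dc Xc]|l].
  by have [+ _] := fP _ Dc; apply.
have /choice[b bP] : forall i, exists b, D i ->
    L b /\ forall x, X i x -> f i x = l -> x < b.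
  move=> i; have [Di|nDi] := pselect (D i); last by exists x0.
  by have [_ /(_ l)[b Lb bP]] := fP _ Di; exists b.
have [||b' Lb' bb'] := @supL (b @` D).
- by move=> _ [i Di <-]; have [] := bP _ Di.
- exact: card_le_trans (card_image_le _ _) Dth.
exists b' => // x /cP[Dc Xc] fl; have [_ xb] := bP _ Dc.
by apply: lt_trans (xb _ Xc fl) _; apply: bb'; exists (c x).
Qed.

Lemma nonstationaryU X Y :
  nonstationary X -> nonstationary Y -> nonstationary (X `|` Y).
Proof.
move=> NX NY; have -> : X `|` Y = \bigcup_(b in [set: bool]) (if b then X else Y).
  apply/seteqP; split=> [t [Xt|Yt]|t [[] _]]; [by exists true|by exists false|
    by left|by right].
apply: nonstationary_bigcup => [|[]//].
apply: card_le_trans (proj1 (infiniteP theta) ith); exact: countableP.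
Qed.

Lemma stationary_fibre X (h : K -> K) : ~ nonstationary X ->
  (forall x, X x -> theta (h x)) ->
  exists2 nu, theta nu & ~ nonstationary [set x | X x /\ h x = nu].
Proof.
move=> SX hth; apply: contrapT => no; apply: SX.
apply: (@nonstationary_sub _
  (\bigcup_(nu in theta) [set x | X x /\ h x = nu])).
  by move=> x Xx; exists (h x) => //; exact: hth.
apply: nonstationary_bigcup => // nu thnu; apply: contrapT => S.
by apply: no; exists nu.
Qed.

(* Cofinality at least theta, hence exactly theta. *)
Definition cof_point x : Prop := L x /\
  forall X, X `<=` below x -> card_lt X theta ->
    exists2 l, l < x & forall y, X y -> y <= l.

Lemma cof_point_gt x : cof_point x -> exists y, y < x.
Proof.
move=> [_ /(_ set0)[//||l lx _]]; last by exists l.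
split; first exact: card_ge0.
by rewrite card_le0 => /eqP th0; apply: ith; rewrite th0; exact: finite_set0.
Qed.

Lemma nonstationary_bounded X b : X `<=` cof_point -> L b -> X `<=` below b ->
  nonstationary X.
Proof.
move=> Xc Lb Xb.
have /choice[f fP] : forall x, exists y, X x -> y < x.
  move=> x; have [/Xc/cof_point_gt[y yx]|nX] := pselect (X x); first by exists y.
  by exists x.
by exists f; split=> // l; exists b => // x /Xb.
Qed.

(* Close off under the bounds of the fibres, theta many times. *)
Lemma cof_point_stationary : ~ nonstationary cof_point.
Proof.
move=> [f [freg fb]].
have /choice[g gP] : forall l, exists b, L b /\
    forall x, cof_point x -> f x = l -> x < b.
  by move=> l; have [b Lb bP] := fb l; exists b.
have [k0 thk0] := infinite_setN0 ith.
have /choice[G GP] : forall a, exists b, L a ->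
    [/\ L b, a < b & forall l, l <= a -> g l < b].
  move=> a; have [La|nLa] := pselect (L a); last by exists a.
  have [||b Lb bP] := @supL ((g @` [set y | y <= a]) `|` [set y | y <= a]).
  - by move=> y [[l la <-]|ya]; [have [] := gP l|exact: oL ya La].
  - apply: cardinal_setU => //; last exact: next_le_below.
    by apply: card_le_trans (card_image_le _ _) _; exact: next_le_below.
  by exists b => _; split=> // [|l la]; apply: bP; [right => /=|left; exists l].
have wfth : well_founded (fun j i => theta j /\ j < i).
  by move=> i; elim/(well_founded_ind wfK): i => i IH; constructor=> j [_ /IH].
(* A chain of length [theta], each term exceeding [G] of all earlier ones; its supremum [x] will be
   a point of cofinality [theta]. *)
have [a aE] := wf_rec
  (fun _ V => xget k0 [set b | L b /\ forall v, V v -> G v < b]) wfth.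
have aP i : L (a i) /\ forall j, theta j -> j < i -> G (a j) < a i.
  elim/(well_founded_ind wfK): i => i IH.
  have aL j : theta j -> j < i -> L (a j) by move=> _ /IH[].
  have [||b Lb bP] := @supL (G @` (a @` [set j | theta j /\ j < i])).
  - by move=> _ [_ [j [thj ji] <-] <-]; have [] := GP _ (aL _ thj ji).
  - do 2 apply: card_le_trans (card_image_le _ _) _.
    by apply: subset_card_le => j [].
  rewrite {1 2}aE; set P := (X in xget k0 X).
  have [] : P (xget k0 P).
    by apply: xgetPex; exists b; split=> // v Vv; apply: bP; exists v.
  by move=> Lx xP; split=> // j thj ji; apply: xP; exists j.
have amono i j : theta i -> i < j -> a i < a j.
  by move=> thi ij; apply: lt_trans ((aP j).2 i thi ij); have [] := GP _ (aP i).1.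
have [||b Lb bP] := @supL (a @` theta).
- by move=> _ [i _ <-]; have [] := aP i.
- exact: card_image_le.
pose D := [set x | L x /\ forall i, theta i -> a i < x].
have [[LD aD] leastD] : is_least D (least k0 D).
  by apply: (@leastP _ _ wfK _ _ b); split=> // i thi; apply: bP; exists i.
set x := least k0 D in LD aD leastD.
have below_x y : y < x -> exists2 i, theta i & y <= a i.
  move=> yx; apply: contrapT => no.
  suff /leastD : D y by rewrite leNgt yx.
  split=> [|i thi]; first exact: oL (ltW yx) LD.
  by rewrite ltNge; apply/negP => ya; apply: no; exists i.
have cx : cof_point x.
  split=> // X Xx [Xth nX].
  have /choice[c cP] : forall y, exists i, X y -> theta i /\ y <= a i.
    move=> y; have [/Xx/below_x[i thi yi]|nXy] := pselect (X y); first by exists i.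
    by exists k0.
  have [||i thi ci] := @regular_sup (c @` X).
  - by move=> _ [y /cP[thc _] <-].
  - split; first exact: card_le_trans (card_image_le _ _) Xth.
    by move=> h; apply: nX; exact: card_le_trans h (card_image_le _ _).
  exists (a i); first exact: aD.
  move=> y Xy; have [thc yc] := cP _ Xy; apply: le_trans yc _.
  by apply: ltW; apply: amono => //; apply: ci; exists y.
(* The contradiction: [f x <= a i] for some [i], whence [x < g (f x) < G (a i) < a j < x]. *)
have [i thi fxi] := below_x _ (freg _ cx).
have [j thj ij] := cardinal_no_max cth ith thi.
have [_ _ /(_ _ fxi) gG] := GP _ (aP i).1.
have := lt_trans (lt_trans (lt_trans ((gP (f x)).2 _ cx erefl) gG)
  ((aP j).2 i thi ij)) (aD j thj).
by rewrite ltxx.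
Qed.

Lemma next_injections : exists e : K -> K -> K, forall b, L b ->
  (forall x, x < b -> theta (e b x)) /\
  (forall x y, x < b -> y < b -> e b x = e b y -> x = y).
Proof.
have [k0 thk0] := infinite_setN0 ith.
suff /choice[e eP] : forall b, exists e : K -> K, L b ->
    (forall x, x < b -> theta (e x)) /\
    (forall x y, x < b -> y < b -> e x = e y -> x = y) by exists e.
move=> b; have [Lb|nLb] := pselect (L b); last by exists id.
by have [e eP] := card_inj k0 Lb; exists e.
Qed.

(* A Ulam matrix argument. *)
Lemma stationary_partition : exists s : K -> K,
  forall g, theta g -> ~ nonstationary [set x | cof_point x /\ s x = g].
Proof.
have [k0 thk0] := infinite_setN0 ith.
have [e eP] := next_injections.
have /choice[nu nuP] : forall h, exists nu, L h -> theta nu /\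
    ~ nonstationary [set x | (cof_point x /\ h < x) /\ e x h = nu].
  move=> h; have [Lh|nLh] := pselect (L h); last by exists h.
  have [||nu thnu S] := @stationary_fibre
    [set x | cof_point x /\ h < x] (fun x => e x h).
  - move=> N; apply: cof_point_stationary.
    have [b Lb hb] := cardinal_no_max cL iL Lh.
    apply: nonstationary_sub (nonstationaryU N
      (@nonstationary_bounded [set x | cof_point x /\ x <= h] b _ Lb _)).
    + move=> x cx; case: (ltP h x) => hx; [by left|by right].
    + by move=> x [].
    + by move=> x [_ xh]; exact: le_lt_trans xh hb.
  - by move=> x [[Lx _] hx]; have [+ _] := eP _ Lx; apply.
  by exists nu.
(* As [L] is larger than [theta], a single value [nu0] serves more than [theta] many [h]; [q] lists
   [theta] of them. *)
have [nu0 thnu0 nu0P] : exists2 nu0, theta nu0 &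
    ~ ([set h | L h /\ nu h = nu0] #<= theta).
  apply: contrapT => no; apply: (next_gt wfK thK).
  apply: card_le_trans (_ : \bigcup_(n in theta) [set h | L h /\ nu h = n] #<= _).
    apply: subset_card_le => h Lh; exists (nu h) => //.
    by have [] := nuP h Lh.
  apply: cardinal_bigcup => // n thn; apply: contrapT => h.
  by apply: no; exists n.
have [q [qP qinj]] := card_inj k0 (card_ltNge nu0P).
(* Injectivity of [e x] leaves at most one such [g] for each [x], so the stationary sets found for
   different [g] are disjoint. *)
exists (fun x => xget k0 [set g | [/\ theta g, q g < x & e x (q g) = nu0]]) => g thg N.
have [Lq nuq] := qP g thg; have [_] := nuP _ Lq; apply; rewrite nuq.
apply: nonstationary_sub N => x [[cx qx] ex]; split=> //.
apply: xget_unique => // g' [thg' qx' ex'].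
have [_ einj] := eP _ cx.1.
by apply: qinj => //; apply: einj => //; rewrite ex ex'.
Qed.

(** [T] is a family so that each value [g] may come with its own large set: part (2) uses a constant
    family, part (4) a different set for each colour. *)
Lemma next_onto : exists F : K * K -> K -> K, forall T : K -> set K,
  (forall g, theta g -> T g `<=` L /\ ~ (T g #<= theta)) ->
  exists p, forall g, theta g -> exists2 t, T g t & F p t = g.
Proof.
have [k0 thk0] := infinite_setN0 ith.
have [e eP] := next_injections.
have [s sS] := stationary_partition.
exists (fun p b => s (least k0 [set x | [/\ p.2 <= x, x < b & e b x <= e b p.1]])).
move=> T TP.
have /choice[be beP] : forall p : K * K, exists b, theta p.1 -> L p.2 ->
    [/\ T p.1 b, L b & p.2 < b].
  move=> [g x] /=; have [[thg Lx]|no] := pselect (theta g /\ L x); last first.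
    by exists x => thg Lx; exfalso; apply: no.
  have [TL nT] := TP _ thg; have [y Ly xy] := cardinal_no_max cL iL Lx.
  have [b Tb yb] := next_unbounded TL nT Ly.
  by exists b => _ _; split=> //; [exact: TL|exact: lt_le_trans xy yb].
pose S g := [set x | cof_point x /\ s x = g].
have /choice[nu nuP] : forall g, exists nu, theta g -> theta nu /\
    ~ nonstationary [set x | S g x /\ e (be (g, x)) x = nu].
  move=> g; have [thg|nthg] := pselect (theta g); last by exists k0.
  have [||nu thnu Snu] := @stationary_fibre (S g) (fun x => e (be (g, x)) x).
  - exact: sS.
  - move=> x [[Lx _] _]; have [_ Lb xb] := beP (g, x) thg Lx.
    by have [+ _] := eP _ Lb; apply.
  by exists nu.
pose S1 g := [set x | S g x /\ e (be (g, x)) x = nu g].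
pose good g xi mu := [/\ theta mu, nu g <= mu & ~ nonstationary
  [set x | (S1 g x /\ xi < x) /\ e (be (g, x)) xi = mu]].
(* For each g, all but fewer than theta many xi are good: otherwise some
   injection e b maps theta many xi below nu g. *)
have bad_le g : theta g -> [set xi | L xi /\ forall mu, ~ good g xi mu] #<= theta.
  move=> thg; have [thnu Snu] := nuP _ thg.
  apply: card_ltNge => thBad.
  have [q [qP qinj]] := card_inj k0 thBad.
  have [||b0 Lb0 qb0] := @supL (q @` theta).
  - by move=> _ [i thi <-]; have [] := qP _ thi.
  - exact: card_image_le.
  apply: Snu; apply: nonstationary_sub (nonstationaryU
    (@nonstationary_bounded [set x | cof_point x /\ x < b0] b0 _ Lb0 _)
    (@nonstationary_bigcup _ (theta `*` theta)
      (fun p => [set x | (nu g <= p.2 /\ S1 g x /\ q p.1 < x) /\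
                         e (be (g, x)) (q p.1) = p.2]) _ _)).
  - move=> x Sx; case: (ltP x b0) => [xb0|b0x]; [left|right].
      by split=> //; case: Sx => -[].
    have [[[Lx _] _] _] := Sx; have [_ Lb xb] := beP (g, x) thg Lx.
    have qx i : theta i -> q i < x.
      by move=> thi; apply: lt_le_trans b0x; apply: qb0; exists i.
    have [eth einj] := eP _ Lb.
    apply: contrapT => no; case: (cth.2 _ thnu) => _; apply.
    apply: (@inj_card _ _ _ _ (fun i => e (be (g, x)) (q i))) => [i thi|i j thi thj].
      rewrite /below/= ltNge; apply/negP => le_nu; apply: no.
      exists (i, e (be (g, x)) (q i)); split=> //=; last by do 2 split=> //; exact: qx.
      by apply: eth; exact: lt_trans (qx _ thi) xb.
    move=> eij; apply: qinj => //; apply: einj eij.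
      exact: lt_trans (qx _ thi) xb.
    exact: lt_trans (qx _ thj) xb.
  - by move=> x [].
  - by move=> x [].
  - exact: cardinal_square.
  - move=> [i mu] [/= thi thmu]; apply: contrapT => N.
    have [_ /(_ mu)] := qP _ thi; apply; split=> //.
      rewrite leNgt; apply/negP => lt_nu; apply: N.
      apply: (@nonstationary_sub _ set0) => [x [[le_nu _] _]|].
        by move: lt_nu; rewrite ltNge le_nu.
      by apply: (@nonstationary_bounded _ b0).
    move=> N'; apply: N; apply: nonstationary_sub N' => x [[_ Sx] ex].
    by split.
(* By regularity of [L] the [theta] many bad sets have a common bound, and a [xi] above it is good
   for every [g] at once. *)
have [xi [Lxi xiP]] : exists xi, L xi /\ forall g, theta g -> exists mu, good g xi mu.
  have /choice[c cP] : forall g, exists c, theta g ->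
      L c /\ [set xi | L xi /\ forall mu, ~ good g xi mu] `<=` below c.
    move=> g; have [thg|nthg] := pselect (theta g); last by exists k0.
    by have [|c Lc cP] := supL _ (bad_le _ thg); [move=> x []|exists c].
  have [||xi Lxi cxi] := @supL (c @` theta).
  - by move=> _ [g thg <-]; have [] := cP _ thg.
  - exact: card_image_le.
  exists xi; split=> // g thg; apply: contrapT => no.
  have [_ /(_ xi)] := cP _ thg.
  have lt_c : c g < xi by apply: cxi; exists g.
  rewrite /below/= ltNge (ltW lt_c) => h.
  by suff : false by []; apply: h; split=> // mu gmu; apply: no; exists mu.
have /choice[mu muP] : forall g, exists mu, theta g -> good g xi mu.
  move=> g; have [thg|nthg] := pselect (theta g); last by exists k0.
  by have [mu] := xiP _ thg; exists mu.
pose S2 g := [set x | (S1 g x /\ xi < x) /\ e (be (g, x)) xi = mu g].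
(* For [x] in [S2 g], injectivity leaves fewer than [theta] points [y < x] with
   [e (be (g, x)) y <= mu g], so they have a bound [la (g, x)] strictly below [x]. *)
have /choice[la laP] : forall p : K * K, exists l, theta p.1 -> S2 p.1 p.2 ->
    l < p.2 /\ forall y, y < p.2 -> e (be p) y <= mu p.1 -> y <= l.
  move=> [g x] /=; have [[thg Sx]|no] := pselect (theta g /\ S2 g x); last first.
    by exists x => thg Sx; exfalso; apply: no.
  have [[[[[Lx cx] _] _] _] _] := Sx.
  have [_ Lb xb] := beP (g, x) thg Lx; have [eth einj] := eP _ Lb.
  have [thmu _ _] := muP _ thg.
  have [|| l lx lP] := cx [set y | y < x /\ e (be (g, x)) y <= mu g].
  - by move=> y [].
  - have [mth nth] := card_le_below_U1 cth ith thmu.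
    have sub : [set y | y < x /\ e (be (g, x)) y <= mu g] #<= [set y | y <= mu g].
      apply: (@inj_card _ _ _ _ (e (be (g, x)))) => [y []//|y z [yx _] [zx _]].
      by apply: einj; exact: lt_trans xb.
    split; first exact: card_le_trans sub mth.
    by move=> h; apply: nth; exact: card_le_trans h sub.
  by exists l => _ _; split=> // y yx ey; apply: lP.
(* [la (g, -)] is regressive on the stationary set [S2 g], so one of its fibres is unbounded; [lm g]
   is the value there. *)
have /choice[lm lmP] : forall g, exists l, theta g ->
    forall b, L b -> exists2 x, S2 g x /\ la (g, x) = l & b <= x.
  move=> g; have [thg|nthg] := pselect (theta g); last by exists k0.
  have [_ _ SS] := muP _ thg; apply: contrapT => no; apply: SS.
  exists (fun x => la (g, x)); split=> [x Sx|l]; first by have [] := laP (g, x) thg Sx.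
  apply: contrapT => nb; apply: no; exists l => _ b Lb.
  apply: contrapT => nx; apply: nb; exists b => // x Sx lax.
  by rewrite ltNge; apply/negP => bx; apply: nx; exists x.
have [||al Lal alP] := @supL (lm @` theta).
- move=> _ [g thg <-]; have [l0 Ll0] := infinite_setN0 iL.
  have [x [Sx <-] _] := lmP _ thg _ Ll0; have [lx _] := laP (g, x) thg Sx.
  by have [[[[[Lx _] _] _] _] _] := Sx; exact: oL (ltW lx) Lx.
- exact: card_image_le.
exists (xi, al) => g thg.
have [x [Sx lax] alx] := lmP _ thg _ Lal.
have [_ xP] := laP (g, x) thg Sx.
have [[[[[Lx _] sx] ex] xix] exi] := Sx.
have [Tb Lb xb] := beP (g, x) thg Lx.
have [_ numu _] := muP _ thg.
exists (be (g, x)) => //=; rewrite exi.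
set P := (X in least k0 X).
have Px : P x by split=> //; rewrite ex.
have [[aly yb ey] yleast] := leastP wfK k0 Px.
(* A smaller [y] in [P] would satisfy [y <= lm g < al <= y]. *)
suff -> : least k0 P = x by [].
apply/eqP; rewrite eq_le (yleast _ Px) leNgt; apply/negP => yx.
have := xP _ yx ey; rewrite lax leNgt.
by rewrite (lt_le_trans _ aly) //; apply: alP; exists g.
Qed.

End Stationary.

(** * Transferring colourings *)

(** A point of [B] outside [A] would have pairwise distinct iterates under an injection of [B] into
    [A], making [B] infinite. *)
Lemma finite_card_eq (T : Type) (A B : set T) :
  finite_set B -> A `<=` B -> B #<= A -> A = B.
Proof.
move=> fB AB BA; apply/seteqP; split=> // x Bx; apply: contrapT => nAx.
have [f [fA finj]] := card_inj x BA.
have iterB n : B (iter n f x) by elim: n => //= n /fA/AB.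
have iter_inj m n : iter m f x = iter n f x -> m = n.
  elim: m n => [|m IH] [|n] //= => [e|e|/finj e]; [..|by rewrite (IH n) // e].
    by exfalso; apply: nAx; rewrite e; exact: fA.
  by exfalso; apply: nAx; rewrite -e; exact: fA.
apply: (proj2 (infiniteP B)) fB.
by apply: (@inj_card _ _ _ _ (fun n => iter n f x)) => // m n _ _; exact: iter_inj.
Qed.

Lemma card_le_lt_trans (T U W : Type) (A : set T) (B : set U) (C : set W) :
  A #<= B -> card_lt B C -> card_lt A C.
Proof.
move=> AB [BC nCB]; split; first exact: card_le_trans AB BC.
by move=> CA; apply: nCB; exact: card_le_trans CA AB.
Qed.

Section Transfer.
Context {d : Order.disp_t} {K : orderType d}.
Context (wfK : well_founded (fun x y : K => x < y)).
Context (infK : infinite_set [set: K]) (cardK : is_cardinal [set: K]).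
Implicit Types (X T B theta mu : set K) (J : set (set K)) (x y a b : K).
Implicit Type Js : set (set (set K)).

Lemma squareK : [set: K] `*` [set: K] #<= [set: K].
Proof. exact: cardinal_square. Qed.

Section Ideal.
Context (V : Type) (N : set V) (J : set (set K)) (JN : ideals N J).

Lemma positive_sub A B : A `<=` B -> ~ J A -> ~ J B.
Proof. by case: JN => -[_ sub _] _ _ AB nA JB; apply: nA; exact: sub AB JB. Qed.

Lemma positive_above A b : ~ J A -> ~ J [set x | A x /\ b < x].
Proof.
case: JN => -[_ sub U] _ bd nA JA; apply: nA.
apply: sub (U _ [set x | x <= b] JA _).
  by move=> x Ax; case: (ltP b x) => bx; [left|right].
by apply: bd; exists b.
Qed.

End Ideal.

(* The index i is coded in K together with eta, and values not allowed by
   regressivity are replaced by the least element of K. *)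
Lemma unbounded_transfer Js theta mu (I : Type) (D : set I) (i0 : I)
    (f : I -> K -> K) :
  Js `<=` ideals [set: nat] -> is_ordinal theta -> theta !=set0 ->
  D #<= [set: K] -> unbounded_p Js mu ->
  exists c, [/\ is_colouring theta c, upper_regressive c &
    forall J, Js J -> forall B, ~ J B -> exists T, [/\ T `<=` mu, otp_eq T mu &
      forall i, D i -> exists eta, forall t, T t -> theta (f i t) ->
        ~ J (fibre c B eta (f i t))]].
Proof.
move=> JsK oth [k0 thk0] DK [c [cmu creg cP]].
have [thbot botle] := leastP wfK k0 thk0.
set bot := least k0 theta in thbot botle.
(* [theta] is an initial segment, so its least element is least in [K]: a colour that is regressive
   at every pair. *)
have {}botle x : bot <= x.
  by rewrite leNgt; apply/negP => xb; have := botle _ (oth _ _ (ltW xb) thbot);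
    rewrite leNgt xb.
have [dec decP] := card_surj (k0, i0)
  (card_le_trans (card_le_setX (card_lexx [set: K]) DK) squareK).
pose clean b v := if pselect (theta v /\ v < b) then v else bot.
exists (fun x b => clean b (f (dec x).2 (c (dec x).1 b))); split.
- by move=> a b ab; rewrite /clean; case: pselect => [[]|].
- move=> a b ab; rewrite /clean; case: pselect => [[]//|n] /=.
  exact: le_lt_trans ab.
move=> J JsJ B nB; have [eta etaP] := cP J JsJ B nB.
exists [set t | mu t /\ ~ J (fibre c B eta t)]; split=> // [t []//|i Di].
have [x _ decx] : exists2 x, [set: K] x & dec x = (eta, i) by exact: decP.
exists x => t [_ nt] thv; set v := f i t in thv *.
(* Bounded sets are in [J], so only the [b] above both the code [x] and the value [v] matter; there
   [clean] changes nothing. *)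
apply: (positive_sub (JsK _ JsJ) _
  (positive_above (b := Order.max x v) (JsK _ JsJ) nt)) => b /= [[Bb eb ct]].
rewrite gt_max => /andP[xb vb]; split=> //.
by rewrite decx /= ct /clean; case: pselect => // -[].
Qed.

(** As [theta] is a cardinal, [theta] many positive colours already have order type [theta]; only
    the size of the image of [T] has to be controlled. *)
Lemma unbounded_spread Js theta mu (I : Type) (D : set I) (i0 : I)
    (f : I -> K -> K) :
  Js `<=` ideals [set: nat] -> is_cardinal theta -> theta !=set0 ->
  D #<= [set: K] ->
  (forall T, T `<=` mu -> otp_eq T mu ->
    exists2 i, D i & theta #<= theta `&` f i @` T) ->
  unbounded_p Js mu -> unbounded_p Js theta.
Proof.
move=> JsK cth th0 DK fP /(unbounded_transfer i0 f JsK cth.1 th0 DK).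
move=> [c [cth' creg cP]]; exists c; split=> // J JsJ B nB.
have [T [Tmu oT TP]] := cP J JsJ B nB.
have [i Di fi] := fP T Tmu oT; have [eta etaP] := TP i Di.
exists eta; apply: cardinal_otp => // [x []//|].
apply: card_le_trans fi _; apply: subset_card_le => v [thv [t Tt ftv]].
by rewrite -ftv in thv *; split=> //; exact: etaP.
Qed.

Lemma onto_spread Js theta mu (I : Type) (D : set I) (i0 : I)
    (f : I -> K -> K) :
  Js `<=` ideals [set: nat] -> is_ordinal theta -> theta !=set0 ->
  D #<= [set: K] ->
  (forall T, T `<=` mu -> otp_eq T mu ->
    exists2 i, D i & theta `<=` f i @` T) ->
  unbounded_p Js mu -> onto_p Js theta.
Proof.
move=> JsK oth th0 DK fP /(unbounded_transfer i0 f JsK oth th0 DK).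
move=> [c [cth' creg cP]]; exists c; split=> // J JsJ B nB.
have [T [Tmu oT TP]] := cP J JsJ B nB.
have [i Di fi] := fP T Tmu oT; have [eta etaP] := TP i Di.
exists eta => tau thtau; have [t Tt ft] := fi _ thtau.
by rewrite -ft in thtau *; exact: etaP.
Qed.

(** * Part (1): lowering the number of colours *)

Lemma otp_preimage X A : otp_eq X A ->
  exists f : K -> K, [/\ forall x, X x -> A (f x),
    forall a, A a -> exists2 x, X x & f x = a &
    forall x y, X x -> X y -> (x < y) = (f x < f y)].
Proof.
move=> [f [[fA finj fsurj] fmono]]; exists f; split=> //.
move=> x y Xx Xy; apply/idP/idP; first exact: fmono.
move=> fxy; rewrite ltNge le_eqVlt; apply/negP => /orP[/eqP yx|/(fmono _ _ Xy Xx)].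
  by move: fxy; rewrite yx ltxx.
by rewrite ltNge (ltW fxy).
Qed.

Lemma proper_ordinal A mu : is_ordinal A -> is_ordinal mu -> A `<` mu ->
  exists2 m, mu m & A `<=` below m.
Proof. by move=> oA omu [_ nA]; exact: (ordinal_sub omu oA nA). Qed.

(* T, a subset of mu, has an initial segment of type A with supremum x;
   fixing one cofinal set of type A in each x lets us project T onto a cofinal
   subset of A by a map depending on x only. *)
Lemma unbounded_regular Js A mu : Js `<=` ideals [set: nat] ->
  is_infinite_regular A -> is_cardinal mu -> A `<` mu ->
  unbounded_p Js mu -> unbounded_p Js A.
Proof.
move=> JsK [cA iA regA] [omu _] Amu.
have [a0 Aa0] := infinite_setN0 iA.
have [m mum Am] := proper_ordinal cA.1 omu Amu.
pose cof x X := [/\ otp_eq X A, X `<=` below x &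
  forall y, y < x -> exists2 z, X z & y <= z].
have /choice[C CP] : forall x, exists C, (exists X, cof x X) -> cof x C.
  move=> x; have [[X cX]|nX] := pselect (exists X, cof x X); first by exists X.
  by exists set0.
have /choice[h hP] : forall x, exists h : K -> K, otp_eq (C x) A ->
    [/\ forall z, C x z -> A (h z), forall a, A a -> exists2 z, C x z & h z = a &
    forall y z, C x y -> C x z -> (y < z) = (h y < h z)].
  move=> x; have [/otp_preimage[h hP]|nC] := pselect (otp_eq (C x) A); first by exists h.
  by exists id.
pose f x t := h x (least a0 [set z | C x z /\ t <= z]).
apply: (@unbounded_spread _ _ _ K [set: K] a0 f) => //; first by exists a0.
move=> T Tmu /otp_preimage[g [gmu gsurj gmono]].
(* [t0] is the point of [T] at position [m]. It lies above the initial segment [X] of type [A], so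
   [X] has a least strict upper bound [x]. *)
have [t0 Tt0 gt0] := gsurj _ mum.
pose X := [set t | T t /\ A (g t)].
have Xt0 : X `<=` below t0.
  by move=> t [Tt /Am Agt]; rewrite /below/= gmono // gt0.
have [xub xleast] := @leastP _ _ wfK t0 [set x | X `<=` below x] t0 Xt0.
set x := least t0 _ in xub xleast.
have Xcof y : y < x -> exists2 z, X z & y <= z.
  move=> yx; apply: contrapT => no; have /xleast : X `<=` below y.
    by move=> z Xz; rewrite /below/= ltNge; apply/negP => yz; apply: no; exists z.
  by rewrite leNgt yx.
have oX : otp_eq X A.
  exists g; split=> [|y z [Ty _] [Tz _]]; last by rewrite gmono.
  split=> [y []//|y z /set_mem[Ty _] /set_mem[Tz _] gyz|a Aa].
    by case: (ltgtP y z) => //; rewrite gmono // gyz ltxx.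
  have [t Tt gt] := gsurj _ (Amu.1 _ Aa).
  by exists t => //; split=> //; rewrite gt.
have [|oC Cx Ccof] := CP x; first by exists X; split=> // t /xub.
have [hA hsurj hmono] := hP x oC.
exists x => //; have fX t : X t -> is_least [set z | C x z /\ t <= z]
    (least a0 [set z | C x z /\ t <= z]).
  by move=> Xt; have [z Cz tz] := Ccof t (xub _ Xt); exact: (@leastP _ _ wfK _ _ z).
apply: card_le_trans (_ : f x @` X #<= _); last first.
  apply: subset_card_le => _ [t Xt <-]; split; last by exists t => //; case: Xt.
  by have [[Cz _] _] := fX _ Xt; exact: hA.
suff : f x @` X #= A by rewrite card_eq_le => /andP[].
apply: regA => [_ [t Xt <-]|a Aa].
  by have [[Cz _] _] := fX _ Xt; exact: hA.
have [y Cy <-] := hsurj _ Aa.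
have [z Xz yz] := Xcof y (Cx _ Cy).
exists (f x z); first by exists z.
have [[Cl zl] _] := fX _ Xz; rewrite leNgt /f -hmono //.
by rewrite -leNgt; exact: le_trans yz zl.
Qed.

(** A point [x] of [T] at a position [m] with [theta] below it has at least [theta] many
    predecessors in [T], and an injection of [below x] into [theta] keeps them distinct. *)
Lemma unbounded_pred Js theta : Js `<=` ideals [set: nat] ->
  is_cardinal theta -> infinite_set theta -> ~ ([set: K] #<= theta) ->
  unbounded_p Js (next_card theta) -> unbounded_p Js theta.
Proof.
move=> JsK cth ith thK.
have [k0 thk0] := infinite_setN0 ith.
have /choice[e eP] : forall x, exists e : K -> K, next_card theta x ->
    (forall y, y < x -> theta (e y)) /\
    (forall y z, y < x -> z < x -> e y = e z -> y = z).
  move=> x; have [Lx|nLx] := pselect (next_card theta x); last by exists id.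
  by have [e eP] := card_inj k0 Lx; exists e.
apply: (@unbounded_spread _ _ _ K [set: K] k0 e) => //; first by exists k0.
move=> T TL /otp_preimage[g [gL gsurj gmono]].
have [m Lm mth] : exists2 m, next_card theta m & theta `<=` below m.
  apply: ordinal_sub; [exact: next_ordinal|exact: cth.1|].
  by move=> /subset_card_le; exact: next_gt.
have [x Tx gx] := gsurj _ Lm; exists x => //.
have [ex einj] := eP _ (TL _ Tx).
have /choice[t tP] : forall a, exists t, theta a -> [/\ T t, t < x & g t = a].
  move=> a; have [tha|ntha] := pselect (theta a); last by exists k0.
  have [t Tt gt] := gsurj _ (sub_next cth tha); exists t => _; split=> //.
  by rewrite gmono // gt gx; exact: mth.
apply: (@inj_card _ _ _ _ (fun a => e x (t a))) => [a /tP[Tt tx _]|a b tha thb].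
  by split; [exact: ex|exists (t a)].
have [_ ax ga] := tP _ tha; have [_ bx gb] := tP _ thb.
by move=> /(einj _ _ ax bx) tab; rewrite -ga tab gb.
Qed.

(** A subset of a finite [mu] of the same size is [mu] itself, so the identity is the only map
    required. *)
Lemma unbounded_finite_lt Js theta mu : Js `<=` ideals [set: nat] ->
  is_cardinal theta -> theta !=set0 -> theta `<=` mu ->
  finite_set mu -> unbounded_p Js mu -> unbounded_p Js theta.
Proof.
move=> JsK cth th0 thmu fmu; have [k0 _] := th0.
have one : [set tt] #<= [set: K] by apply: (@inj_card _ _ _ _ (fun=> k0)) => // -[] [].
apply: (@unbounded_spread _ _ _ unit [set tt] tt (fun=> id)) => // T Tmu oT.
exists tt => //; have TE : T = mu 
    by apply: finite_card_eq => //; move: (otp_card oT); rewrite card_eq_le => /andP[].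
by apply: subset_card_le => t tht; split=> //; exists t => //; rewrite TE; exact: thmu.
Qed.

(** Induction on [n]: a point [x] of [T] gets the new value [n], and the map found for [T] without
    [x] is kept elsewhere. The new index codes the old one together with [x]. *)
Lemma separating_family n : exists f : K -> K -> nat,
  forall T, infinite_set T -> exists i, forall m, (m < n)%N ->
    exists2 t, T t & f i t = m.
Proof.
have [k0 _] := infinite_setN0 infK.
elim: n => [|n [f fP]]; first by exists (fun _ _ => 0%N) => T _; exists k0.
have [g gP] := card_surj (k0, k0) squareK.
exists (fun i t => if t == (g i).2 then n else f (g i).1 t) => T iT.
have [x Tx] := infinite_setN0 iT.
have [|i iP] := fP (T `\ x); first by apply: infinite_setD => //; exact: finite_set1.
have [j _ gj] := gP (i, x) (conj I I).
exists j => m; rewrite ltnS leq_eqVlt gj /= => /orP[/eqP ->|/iP[t [Tt tx] ft]].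
  by exists x => //; rewrite eqxx.
by exists t => //; case: eqP.
Qed.

Lemma unbounded_finite Js theta mu : Js `<=` ideals [set: nat] ->
  is_cardinal theta -> theta !=set0 -> finite_set theta ->
  infinite_set mu -> unbounded_p Js mu -> unbounded_p Js theta.
Proof.
move=> JsK cth th0 [n thn] imu; have [k0 thk0] := th0.
have [f fP] := separating_family n.
have /andP[thI Ith] : (theta #<= `I_n) && (`I_n #<= theta) by rewrite -card_eq_le.
have [h [hth hinj]] := card_inj k0 Ith.
apply: (@unbounded_spread _ _ _ K [set: K] k0 (fun i t => h (f i t))) => //.
move=> T Tmu /otp_card Tm.
have [|i iP] := fP T.
  move=> fT; apply: imu; apply: card_le_finite fT.
  by move: Tm; rewrite card_eq_le => /andP[].
exists i => //; apply: card_le_trans thI _.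
apply: (@inj_card _ _ _ _ h) => // m mn; split; first exact: hth.
by have [t Tt ft] := iP m mn; exists t => //; rewrite ft.
Qed.

Lemma lt_cardinal theta mu : is_ordinal theta -> is_cardinal mu ->
  theta `<` mu -> ~ (mu #<= theta).
Proof.
move=> oth cmu /(proper_ordinal oth cmu.1)[m mum thm] muth.
case: (cmu.2 _ mum) => _; apply.
exact: card_le_trans muth (subset_card_le thm).
Qed.

Lemma lt_cardinalT theta mu : is_ordinal theta -> is_cardinal mu ->
  theta `<` mu -> ~ ([set: K] #<= theta).
Proof.
move=> oth cmu /(lt_cardinal oth cmu) nmu h.
by apply: nmu; exact: card_le_trans (card_leT mu) h.
Qed.

(** The successor of [theta] either equals [mu] or is a regular proper initial segment of it, where
    [unbounded_regular] applies. *)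
Lemma unbounded_next Js theta mu : Js `<=` ideals [set: nat] ->
  is_cardinal theta -> infinite_set theta -> is_cardinal mu -> theta `<` mu ->
  unbounded_p Js mu -> unbounded_p Js (next_card theta).
Proof.
move=> JsK cth ith cmu thmu U.
have nmu := lt_cardinal cth.1 cmu thmu.
have thK := lt_cardinalT cth.1 cmu thmu.
have Lmu : next_card theta `<=` mu.
  move=> x Lx; apply: contrapT => nx; apply: nmu.
  apply: card_le_trans Lx; apply: subset_card_le => y muy.
  by rewrite /below/= ltNge; apply/negP => xy; apply: nx; exact: cmu.1 xy muy.
have [muL|muL] := pselect (mu `<=` next_card theta).
  by have <- : mu = next_card theta by apply/seteqP.
by apply: (unbounded_regular JsK _ cmu _ U) => //; exact: next_regular.
Qed.

(** An infinite [theta] may be singular, so the descent passes through its successor, which is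
    regular. *)
Lemma unbounded_lt Js theta mu : Js `<=` ideals [set: nat] ->
  is_cardinal theta -> theta !=set0 -> is_cardinal mu -> theta `<` mu ->
  unbounded_p Js mu -> unbounded_p Js theta.
Proof.
move=> JsK cth th0 cmu thmu U.
have [fmu|imu] := pselect (finite_set mu).
  exact: (unbounded_finite_lt JsK cth th0 thmu.1 fmu U).
have [fth|ith] := pselect (finite_set theta).
  exact: (unbounded_finite JsK cth th0 fth imu U).
apply: unbounded_pred => //; first exact: (lt_cardinalT cth.1 cmu thmu).
exact: (unbounded_next JsK cth ith cmu thmu U).
Qed.

(** * Parts (2) and (3): all colours on a single positive set *)

Lemma onto_regular Js theta mu : Js `<=` ideals [set: nat] ->
  is_infinite_regular theta -> is_cardinal mu -> theta `<` mu ->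
  unbounded_p Js mu -> onto_p Js theta.
Proof.
move=> JsK rth cmu thmu U; have [cth ith _] := rth.
have thK := lt_cardinalT cth.1 cmu thmu.
have [k0 thk0] := infinite_setN0 ith.
have [F FP] := next_onto wfK rth thK.
apply: (@onto_spread _ _ (next_card theta) _ [set: K * K] (k0, k0) F JsK cth.1).
- by exists k0.
- by apply: card_le_trans squareK; apply: subset_card_le.
- move=> T TL oT; have [|p pP] := FP (fun=> T).
    move=> g _; split=> // Tth; apply: (next_gt wfK thK (theta := theta)).
    by apply: card_le_trans Tth; move: (otp_card oT); rewrite card_eq_le => /andP[].
  by exists p => // g /pP[t Tt Ft]; exists t.
- exact: unbounded_next U.
Qed.

(** The maps are indexed by the subsets of [theta] themselves: one of order type [theta] is sent
    onto [theta] by its own collapse. *)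
Lemma onto_powerset Js theta : Js `<=` ideals [set: nat] ->
  is_cardinal theta -> theta !=set0 ->
  [set X : set K | X `<=` theta] #<= [set: K] ->
  unbounded_p Js theta -> onto_p Js theta.
Proof.
move=> JsK cth th0 powK.
have /choice[f fP] : forall X : set K, exists f : K -> K,
    otp_eq X theta -> theta `<=` f @` X.
  move=> X; have [/otp_preimage[f [_ fsurj _]]|nX] := pselect (otp_eq X theta).
    by exists f => _ a /fsurj[x Xx fx]; exists x.
  by exists id.
apply: (@onto_spread _ _ theta _ _ set0 f JsK cth.1 th0 powK) => T Tth oT.
by exists T => //; exact: fP.
Qed.

(** * Part (4): one [eta] for a whole sequence of positive sets *)

Lemma onto_pp_regular Js theta mu : Js `<=` ideals [set: nat] ->
  is_infinite_regular theta -> is_cardinal mu -> theta `<` mu ->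
  (exists2 D, cofinal_family (subsets_of_size theta) D & D #<= [set: K]) ->
  unbounded_p Js mu ->
  onto_pp (ideals (succ_card (succ_card theta)) `&` Js) theta.
Proof.
move=> JsK rth cmu thmu [D [Dth Dcof] DK] U; have [cth ith _] := rth.
have thK := lt_cardinalT cth.1 cmu thmu.
have [k0 thk0] := infinite_setN0 ith.
have [F FP] := next_onto wfK rth thK.
have [c [cL creg cP]] := unbounded_next JsK cth ith cmu thmu U.
set L := next_card theta in FP cL cP.
have DK2 : D `*` [set: K * K] #<= [set: K].
  apply: card_le_trans squareK; apply: card_le_setX => //.
  by apply: card_le_trans squareK; apply: subset_card_le.
have [dec decP] := card_surj (set0, (k0, k0)) DK2.
(* By regularity of [L], the colours [c y b] with [y] in [Y] below [b] have a bound [phi (Y, b)] in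
   [L]. *)
have /choice[phi phiP] : forall p : set K * K, exists l, D p.1 ->
    L l /\ forall y, p.1 y -> y < p.2 -> c y p.2 <= l.
  move=> [Y b] /=; have [DY|nDY] := pselect (D Y); last by exists k0.
  have [||l Ll lP] := @next_sup _ _ wfK theta cth ith thK
      ((fun y => c y b) @` [set y | Y y /\ y < b]).
  - by move=> _ [y [_ yb] <-]; exact: cL.
  - apply: card_le_trans (card_image_le _ _) _.
    apply: card_le_trans (_ : _ #<= Y) _; first by apply: subset_card_le => y [].
    by have := Dth _ DY; rewrite /subsets_of_size/= card_eq_le => /andP[].
  by exists l => _; split=> // y Yy yb; apply: ltW; apply: lP; exists y.
pose clean v := if pselect (theta v) then v else k0.
exists (fun x b => clean (F (dec x).2 (phi ((dec x).1, b)))); split.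
  by move=> a b ab; rewrite /clean; case: pselect.
move=> J [[_ Jcomp _] JsJ] B nB.
have JN := JsK _ JsJ.
have /choice[eta etaP] : forall tau, exists eta, theta tau -> otp_eq
    [set t | L t /\ ~ J (fibre c (B tau) eta t)] L.
  move=> tau; have [thtau|nthtau] := pselect (theta tau); last by exists k0.
  by have [eta etaP] := cP J JsJ _ (nB _ thtau); exists eta.
have [Y DY etaY] : exists2 Y, D Y & eta @` theta `<=` Y.
  (* Adding [theta] makes the size exactly [theta], even if few of the [eta tau] are distinct. *)
  have [|Y DY etaY] := Dcof (eta @` theta `|` theta); last first.
    by exists Y => // y etay; apply: etaY; left.
  rewrite /subsets_of_size/= card_eq_le; apply/andP; split.
    by apply: cardinal_setU => //; exact: card_image_le.
  by apply: subset_card_le => t; right.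
(* theta^{++}-completeness is used here: B tau splits into theta^+ fibres of
   phi (Y, -), which dominates the colour c (eta tau, -). *)
pose T tau := [set l | L l /\ ~ J [set b | B tau b /\ phi (Y, b) = l]].
have [|p pP] := FP T.
  move=> tau thtau; split=> [l []//|Tth].
  (* If [T tau] were bounded by [b], a positive colour [t >= b] at [eta tau] would have a positive
     part on which [phi (Y, -)] is a constant [l]. Then [l >= t >= b], although [l] is in
     [T tau]. *)
  have [b Lb Tb] := next_sup wfK cth ith thK (fun l => @proj1 _ _) Tth.
  pose S := [set t | L t /\ ~ J (fibre c (B tau) (eta tau) t)].
  have [t [Lt nt] bt] : exists2 t, S t & b <= t.
    apply: (next_unbounded (theta := theta)) => // [t []//|Sth].
    apply: (next_gt wfK thK (theta := theta)); apply: card_le_trans Sth.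
    by move: (otp_card (etaP _ thtau)); rewrite card_eq_le => /andP[].
  pose part l := [set b | fibre c (B tau) (eta tau) t b /\ phi (Y, b) = l].
  have [l Ll nl] : exists2 l, L l & ~ J (part l).
    apply: contrapT => no; apply: nt; have [[_ Jsub _] _ _] := JN.
    apply: Jsub (Jcomp (part @` L) _ _).
    - move=> b0 fb0; exists (part (phi (Y, b0))) => //.
      by exists (phi (Y, b0)) => //; have [] := phiP (Y, b0) DY.
    - by move=> _ [l Ll <-]; apply: contrapT => nl; apply: no; exists l.
    - apply: card_le_lt_trans (succ_card_gt (succ_card theta)).
      apply: card_le_trans (card_image_le _ _) _.
      by apply: next_least => //; exact: succ_card_gt.
  have [b0 [[Bb0 etab0 cb0] phib0]] : part l !=set0.
    apply: contrapT => no; apply: nl; have [[[X JX] Jsub _] _ _] := JN.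
    by apply: Jsub JX => b0 pb0; exfalso; apply: no; exists b0.
  have /Tb : T tau l.
    by split=> //; apply: (positive_sub JN _ nl) => b1 [[Bb1 _ _] phib1].
  have [_ /(_ (eta tau)) le_l] := phiP (Y, b0) DY.
  rewrite /below/= ltNge -phib0; apply/negP; apply/negPn.
  by apply: le_trans bt _; rewrite -cb0; apply: le_l => //; apply: etaY; exists tau.
have [x _ decx] : exists2 x, [set: K] x & dec x = (Y, p) by exact: decP.
exists x => tau thtau; have [l [Ll nl] Fl] := pP _ thtau.
apply: (positive_sub JN _ (positive_above (b := x) JN nl)) => b [[Bb phib] xb].
by split=> //; rewrite decx /= phib Fl /clean; case: pselect.
Qed.

End Transfer.

Theorem corollary4p18 (d : Order.disp_t) (K : orderType d)
  (wfK : well_founded (fun x y : K => x < y))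
  (infK : infinite_set [set: K])
  (cardK : is_cardinal [set: K])
  (Js : set (set (set K)))
  (JsK : Js `<=` ideals [set: nat])
  (mu : set K)
  (card_mu : is_cardinal mu)
  (unb_mu : unbounded_p Js mu) :
  [/\ (forall theta : set K, is_cardinal theta -> `I_2 #<= theta ->
         theta `<` mu -> unbounded_p Js theta),
      (forall theta : set K, is_infinite_regular theta ->
         theta `<` mu -> onto_p Js theta),
      (forall theta : set K, is_cardinal theta -> `I_2 #<= theta ->
         theta `<=` mu -> [set X : set K | X `<=` theta] #<= [set: K] ->
         onto_p Js theta) &
      (forall theta : set K, is_infinite_regular theta -> theta `<` mu ->
         cf_eq (subsets_of_size theta) [set: K] ->
         onto_pp (ideals (succ_card (succ_card theta)) `&` Js) theta)].
Proof.
have nonempty (theta : set K) : `I_2 #<= theta -> theta !=set0.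
  move=> h; apply/set0P/eqP => th0; move: h; rewrite th0 card_le0 => /eqP.
  by move=> /seteqP[/(_ 0%N erefl)].
split=> [theta cth /nonempty th0 thmu|theta rth thmu|theta cth /nonempty th0 thmu|
  theta rth thmu [[D [Dcof DK]] _]].
- exact: (unbounded_lt wfK infK cardK JsK cth th0 card_mu thmu unb_mu).
- exact: (onto_regular wfK infK cardK JsK rth card_mu thmu unb_mu).
- move=> powK; apply: onto_powerset => //.
  have [muth|nmuth] := pselect (mu `<=` theta).
    by have -> : theta = mu by apply/seteqP.
  exact: (unbounded_lt wfK infK cardK JsK cth th0 card_mu _ unb_mu).
- apply: (onto_pp_regular wfK infK cardK JsK rth card_mu thmu _ unb_mu).
  by exists D => //; move: DK; rewrite card_eq_le => /andP[].
Qed.
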